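(* Let $0<r<1$ and let $U_r=\bigcup_{-1<x<1}D_\rho(x,r)$ be the union of all pseudohyperbolic disks of radius $r$ with center $x\in\,]-1,1[$. Then: (1) The upper boundary $\mathscr C^+$ of $U_r$ is an arc of the circle $$\mathfrak C=\left\{w\in\mathbb C:\ \left|w+i\,\frac{1-r^2}{2r}\right|=\frac{1+r^2}{2r}\right\},$$ and the lower boundary of $U_r$ is the reflection of $\mathscr C^+$ with respect to the real axis. (2) The tangent of the angle $\beta$ under which $\mathscr C^+$ cuts the real axis is $\tan\beta=\dfrac{2r}{1-r^2}$.
   Context: $\mathbb D=\{z\in\mathbb C:|z|<1\}$ is the open unit disk. The pseudohyperbolic distance of $a,b\in\mathbb D$ is $\rho(a,b)=\left|\frac{a-b}{1-\overline a\,b}\right|$. For $a\in\mathbb D$ and $0<r<1$, the pseudohyperbolic disk centered at $a$ with radius $r$ is $D_\rho(a,r)=\{z\in\mathbb D:\rho(z,a)<r\}$. The upper (respectively lower) boundary of $U_r$ is the part of the topological boundary of $U_r$ in $\mathbb C$ lying in the closed upper half-plane $\{\operatorname{Im} z\ge 0\}$ (respectively the closed lower half-plane $\{\operatorname{Im} z\le 0\}$). The curve $\mathscr C^+$ meets the real axis at the points $-1$ and $1$; the angle $\beta\in\,]0,\pi/2[$ under which it cuts the real axis is the angle at each of these points between the tangent line to $\mathscr C^+$ and the real axis. *)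

(* Defs.v *)
From Stdlib Require Import Reals.
From Coquelicot Require Import Coquelicot.

Open Scope R_scope.

Definition unit_disk (z : C) : Prop := Cmod z < 1.

Definition rho (a b : C) : R := Cmod ((a - b) / (1 - Cconj a * b))%C.

Definition rho_disk (a : C) (r : R) (z : C) : Prop :=
  unit_disk z /\ rho z a < r.

Definition U (r : R) (z : C) : Prop :=
  exists x : R, -1 < x < 1 /\ rho_disk (RtoC x) r z.

Definition closure {T : UniformSpace} (A : T -> Prop) (x : T) : Prop :=
  forall P : T -> Prop, locally x P -> exists y, P y /\ A y.

Definition boundary {T : UniformSpace} (A : T -> Prop) (x : T) : Prop :=
  closure A x /\ ~ locally x A.

Definition upper_boundary (A : C -> Prop) (z : C) : Prop :=
  boundary A z /\ 0 <= Im z.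

Definition lower_boundary (A : C -> Prop) (z : C) : Prop :=
  boundary A z /\ Im z <= 0.

(* [A] is the image of an injective continuous map from [0, 1]; continuity is
   relative to [0, 1], the values of [g] elsewhere being irrelevant. *)
Definition is_arc (A : C -> Prop) : Prop :=
  exists g : R -> C,
    (forall t, 0 <= t <= 1 ->
       filterlim g (within (fun s => 0 <= s <= 1) (locally t)) (locally (g t))) /\
    (forall s t, 0 <= s <= 1 -> 0 <= t <= 1 -> g s = g t -> s = t) /\
    (forall z, A z <-> exists t, 0 <= t <= 1 /\ g t = z).

Definition is_arc_of (K A : C -> Prop) : Prop :=
  is_arc A /\ forall z, A z -> K z.

(* Unoriented angle, in [0, PI/2], between two lines with nonzero direction
   vectors [u] and [v]; [Re (u * Cconj v)] is the Euclidean inner product. *)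
Definition line_angle (u v : C) : R :=
  acos (Rabs (Re (u * Cconj v)%C) / (Cmod u * Cmod v)).

(* The line through [p] with direction [u] is the limit of the secants joining
   [p] to the points of [A] that tend to [p].  The second condition,
   that [p] be an accumulation point of [A], keeps the limit from being
   vacuous; an endpoint of an arc is allowed. *)
Definition tangent_direction (A : C -> Prop) (p u : C) : Prop :=
  u <> RtoC 0 /\
  closure (fun z : C => A z /\ z <> p) p /\
  filterlim (fun z : C => line_angle (z - p)%C u)
    (within A (locally' p)) (locally 0).

(* [A] has a tangent line at [p], which makes the angle [b] with the lines of
   direction [v]. *)
Definition cuts_under_angle (A : C -> Prop) (p v : C) (b : R) : Prop :=
  (exists u, tangent_direction A p u) /\
  (forall u, tangent_direction A p u -> line_angle u v = b).

(* Main.v *)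
Require Import Defs.
From Stdlib Require Import Reals Lra FunctionalExtensionality PropExtensionality.
From Coquelicot Require Import Coquelicot.

(** Membership of a point [z] of the unit disk in one of the disks
    [rho_disk t r] is a quadratic inequality [q t < 0] in the real centre [t]
    ([rho_lt_iff_quadratic]), with positive leading coefficient.  So [z] lies in
    the union [U r] exactly when the minimum of [q] is negative and attained in
    ]-1, 1[.  The second condition holds for every [z] in the unit disk, and the
    discriminant of [q] factors in such a way that the first one becomes
    [|Im z| (1 - r^2) < r (1 - |z|^2)].  Hence [U r] is a symmetric lens
    ([U_iff]), and its boundary is the set where equality holds
    ([boundary_U_iff]): no point of that set is in [U r], but shrinking such a
    point towards 0 moves it into [U r].

    In the closed upper half-plane the equality is the equation of the circle
    with centre [-i c], [c = (1 - r^2) / (2 r)], that passes through [-1] and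
    [1]; its radius is [(1 + r^2) / (2 r)] because
    [1 + c^2 = ((1 + r^2) / (2 r))^2].  The part [cap c] of that circle in the
    closed upper half-plane is a graph over [-1, 1], therefore an arc, and it
    meets the real axis at the two ends of the interval.

    At an end [s] (with [s^2 = 1]) the tangent is orthogonal to the radius
    [s + i c], so it has direction [c - i s]: the sine of the angle between this
    line and a chord from [s] is the length of the chord over the diameter of
    the circle ([cap_tangent_direction]).  A set has at most one tangent line
    at a point ([tangent_direction_parallel]), so every tangent direction makes
    with the real axis the angle whose tangent is [1 / c = 2 r / (1 - r^2)]. *)

Open Scope R_scope.

(** * The union of the disks is a lens *)

Lemma lt_iff_square_lt (a b : R) :
  0 <= a -> 0 <= b -> (a < b <-> a ^ 2 < b ^ 2).
Proof.
  intros Ha Hb; split; intros H; nra.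
Qed.

Lemma Cmod_square (z : C) : Cmod z ^ 2 = Re z ^ 2 + Im z ^ 2.
Proof.
  unfold Cmod; rewrite pow2_sqrt; [reflexivity | unfold Re, Im; nra].
Qed.

(** The boundary of the region where this is negative consists of two circular
    arcs, symmetric in the real axis, that meet at [-1] and [1]. *)
Definition lens_defect (r : R) (z : C) : R :=
  Rabs (Im z) * (1 - r ^ 2) - r * (1 - (Re z ^ 2 + Im z ^ 2)).

Lemma unit_disk_iff (z : C) : unit_disk z <-> Re z ^ 2 + Im z ^ 2 < 1.
Proof.
  unfold unit_disk.
  rewrite lt_iff_square_lt, Cmod_square by (try apply Cmod_ge_0; lra).
  now rewrite pow1.
Qed.

(** Squaring [|z - t| < r |1 - conj z t|] gives a polynomial inequality of
    degree 2 in [t]. *)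
Lemma rho_lt_iff_quadratic (r t : R) (z : C) :
  0 < r -> -1 < t < 1 -> unit_disk z ->
  (rho z (RtoC t) < r <->
   (1 - r ^ 2 * (Re z ^ 2 + Im z ^ 2)) * t ^ 2
     - 2 * (Re z * (1 - r ^ 2)) * t + (Re z ^ 2 + Im z ^ 2 - r ^ 2) < 0).
Proof.
  intros Hr Ht Hz; apply unit_disk_iff in Hz.
  unfold rho; set (d := (1 - Cconj z * RtoC t)%C).
  assert (Hd2 : Cmod d ^ 2 = 1 - 2 * Re z * t + t ^ 2 * (Re z ^ 2 + Im z ^ 2)).
  { rewrite Cmod_square; unfold d; destruct z as [x y]; cbn -[pow]; ring. }
  assert (Hd : 0 < Cmod d).
  { assert (0 <= Cmod d) by apply Cmod_ge_0.
    assert (0 < Cmod d ^ 2); [rewrite Hd2 | nra].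
    assert (0 <= (Re z * t - 1) ^ 2) by apply pow2_ge_0.
    (* The value is [(Re z t - 1)^2 + (Im z t)^2], and [Re z t = 1] is impossible
       as both factors have modulus less than 1. *)
    destruct (Req_dec (Re z * t) 1) as [E | E]; [| nra].
    assert (Re z ^ 2 < 1) by nra. nra. }
  rewrite Cmod_div by (now apply Cmod_gt_0).
  assert (Hq : Cmod (z - RtoC t) / Cmod d < r <->
               Cmod (z - RtoC t) < r * Cmod d).
  { split; intros H.
    - apply Rmult_lt_compat_r with (r := Cmod d) in H; [| easy].
      now replace (Cmod (z - RtoC t) / Cmod d * Cmod d)
        with (Cmod (z - RtoC t)) in H by (field; lra).
    - apply Rmult_lt_reg_r with (Cmod d); [easy |].
      now replace (Cmod (z - RtoC t) / Cmod d * Cmod d)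
        with (Cmod (z - RtoC t)) by (field; lra). }
  rewrite Hq, lt_iff_square_lt by (try apply Cmod_ge_0; nra).
  rewrite Rpow_mult_distr, Hd2, Cmod_square.
  destruct z as [x y]; cbn -[pow].
  split; intros H; nra.
Qed.

(** With [N = |z|^2], the quadratic in [t] has leading coefficient
    [1 - r^2 N > 0] and its minimum is negative if and only if
    [(N - r^2) (1 - r^2 N) < (Re z)^2 (1 - r^2)^2].  The left-hand side is
    [N (1 - r^2)^2 - r^2 (1 - N)^2], so this means
    [(Im z)^2 (1 - r^2)^2 < r^2 (1 - N)^2].  The minimizer
    [Re z (1 - r^2) / (1 - r^2 N)] is always an admissible centre. *)
Lemma U_iff (r : R) (z : C) : 0 < r < 1 -> (U r z <-> lens_defect r z < 0).
Proof.
  intros Hr; unfold U, rho_disk, lens_defect.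
  set (N := Re z ^ 2 + Im z ^ 2).
  assert (Hy : Im z ^ 2 = Rabs (Im z) ^ 2) by (symmetry; apply pow2_abs).
  assert (Hy0 := Rabs_pos (Im z)).
  assert (Hdisc : (N - r ^ 2) * (1 - r ^ 2 * N) - (Re z * (1 - r ^ 2)) ^ 2
    = (Rabs (Im z) * (1 - r ^ 2)) ^ 2 - (r * (1 - N)) ^ 2).
  { rewrite (Rpow_mult_distr (Rabs _)), <- Hy; unfold N; ring. }
  assert (Hr2 : 0 < 1 - r ^ 2) by nra.
  split.
  - intros (t & Ht & Hz & Hrho).
    apply rho_lt_iff_quadratic in Hrho; [| lra | easy | easy].
    apply unit_disk_iff in Hz; fold N in Hz, Hrho.
    assert (Ha : 0 < 1 - r ^ 2 * N) by nra.
    assert (H := pow2_ge_0 ((1 - r ^ 2 * N) * t - Re z * (1 - r ^ 2))).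
    cut (Rabs (Im z) * (1 - r ^ 2) < r * (1 - N)); [lra |].
    apply lt_iff_square_lt; [nra | nra |].
    apply Rmult_lt_compat_l with (r := 1 - r ^ 2 * N) in Hrho; [| easy].
    nra.
  - intros H.
    assert (HN : N < 1) by nra.
    assert (HN0 : 0 <= N) by (unfold N; nra).
    assert (Ha : 0 < 1 - r ^ 2 * N) by nra.
    assert (Hx : Re z ^ 2 <= N) by (unfold N; nra).
    assert (Hb : Rabs (Re z * (1 - r ^ 2)) < 1 - r ^ 2 * N).
    { rewrite Rabs_mult, (Rabs_pos_eq (1 - r ^ 2)) by lra.
      assert (Hs := sqrt_pos N). assert (Hs2 := pow2_sqrt N HN0).
      assert (Hs1 : sqrt N < 1) by (apply lt_iff_square_lt; lra).
      assert (Rabs (Re z) <= sqrt N).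
      { apply Rsqr_incr_0_var; [| easy].
        rewrite <- Rsqr_abs; unfold Rsqr; nra. }
      apply Rle_lt_trans with (sqrt N * (1 - r ^ 2)); [nra |].
      (* The product is [(1 - r^2 N) - sqrt N (1 - r^2)]. *)
      assert (0 < (1 - sqrt N) * (1 + r ^ 2 * sqrt N))
        by (apply Rmult_lt_0_compat; nra).
      nra. }
    apply Rabs_def2 in Hb.
    exists (Re z * (1 - r ^ 2) / (1 - r ^ 2 * N)).
    assert (Ht : -1 < Re z * (1 - r ^ 2) / (1 - r ^ 2 * N) < 1).
    { split; apply Rmult_lt_reg_r with (1 - r ^ 2 * N); try easy;
        unfold Rdiv; rewrite ?Rmult_assoc, Rinv_l, ?Rmult_1_r; lra. }
    assert (Hz : unit_disk z) by (apply unit_disk_iff; exact HN).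
    split; [easy | split; [easy |]].
    apply rho_lt_iff_quadratic; [lra | easy | easy |]; fold N.
    apply Rmult_lt_reg_l with (1 - r ^ 2 * N); [easy |].
    match goal with |- ?l < ?e => replace l with
      ((N - r ^ 2) * (1 - r ^ 2 * N) - (Re z * (1 - r ^ 2)) ^ 2) by (field; lra);
      rewrite Rmult_0_r end.
    rewrite Hdisc.
    cut ((Rabs (Im z) * (1 - r ^ 2)) ^ 2 < (r * (1 - N)) ^ 2); [lra |].
    apply -> lt_iff_square_lt; [lra | |]; apply Rmult_le_pos; lra.
Qed.

Lemma continuous_Re (z : C) : continuous Re z.
Proof. destruct z; apply continuous_fst. Qed.

Lemma continuous_Im (z : C) : continuous Im z.
Proof. destruct z; apply continuous_snd. Qed.

Lemma continuous_square_comp {T : UniformSpace} (f : T -> R) (x : T) :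
  continuous f x -> continuous (fun t => f t ^ 2) x.
Proof.
  intros Hf; apply continuous_ext with (fun t => f t * f t);
    [intros; simpl; ring |].
  now apply (@continuous_mult T R_AbsRing).
Qed.

Lemma continuous_pair {T : UniformSpace} (f g : T -> R) (x : T) :
  continuous f x -> continuous g x -> continuous (fun t => (f t, g t) : C) x.
Proof.
  intros Hf Hg; apply (continuous_comp_2 f g (fun a b => (a, b) : C)); try easy.
  apply continuous_ext with (fun p => p); [now intros [] | apply continuous_id].
Qed.

Lemma continuous_lens_defect (r : R) (z : C) : continuous (lens_defect r) z.
Proof.
  unfold lens_defect.
  apply (@continuous_minus C_UniformSpace R_AbsRing R_NormedModule).
  - apply (@continuous_mult C_UniformSpace R_AbsRing);
      [| apply continuous_const].
    apply continuous_comp; [apply continuous_Im | apply continuous_Rabs].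
  - apply (@continuous_mult C_UniformSpace R_AbsRing);
      [apply continuous_const |].
    apply (@continuous_minus C_UniformSpace R_AbsRing R_NormedModule);
      [apply continuous_const |].
    apply (@continuous_plus C_UniformSpace R_AbsRing R_NormedModule);
      apply continuous_square_comp; [apply continuous_Re | apply continuous_Im].
Qed.

(** The two terms that depend on [z] scale by [s] and [s^2], while the constant
    term [- r] does not scale. *)
Lemma lens_defect_contract (r s : R) (z : C) :
  0 < r < 1 -> 0 < s < 1 -> lens_defect r z = 0 ->
  lens_defect r (s * Re z, s * Im z) < 0.
Proof.
  unfold lens_defect; intros Hr Hs H; cbn -[pow].
  rewrite Rabs_mult, (Rabs_pos_eq s) by lra.
  assert (0 <= r * (Re z ^ 2 + Im z ^ 2)) by nra.
  assert (0 <= s * (1 - s)) by nra.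
  replace (s * Rabs (Im z) * (1 - r ^ 2)) with
    (s * (r * (1 - (Re z ^ 2 + Im z ^ 2)))) by nra.
  nra.
Qed.

(** Continuity alone gives only that the boundary lies in the zero set; the
    converse needs points of [U r] close to each zero, and those on the segment
    from the zero to 0 will do. *)
Lemma boundary_U_iff (r : R) (z : C) :
  0 < r < 1 -> (boundary (U r) z <-> lens_defect r z = 0).
Proof.
  intros Hr; split.
  - intros [Hcl Hint].
    assert (Hc := continuous_lens_defect r z).
    destruct (Rtotal_order (lens_defect r z) 0) as [H | [H | H]]; [| easy |].
    + destruct Hint.
      assert (Hloc := Hc _ (open_lt 0 _ H)).
      revert Hloc; unfold filtermap; apply filter_imp; intros w Hw.
      now apply U_iff.
    + destruct (Hcl _ (Hc _ (open_gt 0 _ H))) as (w & Hw & HU).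
      apply U_iff in HU; [lra | easy].
  - intros H; split.
    + intros P HP.
      assert (Hseg : continuous (fun s : R => (s * Re z, s * Im z) : C) 1).
      { apply continuous_pair; apply (@continuous_mult R_UniformSpace R_AbsRing);
          (apply continuous_id || apply continuous_const). }
      assert (Hz : (1 * Re z, 1 * Im z) = z)
        by (destruct z; unfold Re, Im; simpl; now rewrite 2 Rmult_1_l).
      destruct (Hseg P) as [e He]; [now rewrite Hz |].
      assert (He0 := cond_pos e).
      set (h := Rmin (e / 2) (1 / 2)).
      assert (Hh : 0 < h <= 1 / 2 /\ h < e).
      { unfold h; unfold Rmin; destruct (Rle_dec (e / 2) (1 / 2)); lra. }
      exists ((1 - h) * Re z, (1 - h) * Im z); split.
      * apply (He (1 - h)).
        change (Rabs ((1 - h) - 1) < e); rewrite Rabs_left; lra.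
      * apply U_iff; [easy |]; apply lens_defect_contract; lra.
    + intros HU; apply locally_singleton, U_iff in HU; [lra | easy].
Qed.

(** * The upper boundary is a circular arc *)

(** The part in the closed upper half-plane of the circle with centre [-i c]
    through [-1] and [1]. *)
Definition cap (c : R) (z : C) : Prop :=
  0 <= Im z /\ Re z ^ 2 + (Im z + c) ^ 2 = 1 + c ^ 2.

(** An equality of predicates, so that it can be rewritten inside [is_arc] and
    [cuts_under_angle]. *)
Lemma upper_boundary_U (r : R) :
  0 < r < 1 -> upper_boundary (U r) = cap ((1 - r ^ 2) / (2 * r)).
Proof.
  intros Hr; apply functional_extensionality; intros z.
  apply propositional_extensionality.
  unfold upper_boundary, cap; rewrite boundary_U_iff by easy.
  unfold lens_defect.
  set (c := (1 - r ^ 2) / (2 * r)).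
  assert (Hc : 1 - r ^ 2 = 2 * r * c) by (unfold c; field; lra).
  rewrite Hc.
  split; intros [H1 H2].
  - rewrite Rabs_pos_eq in H1 by easy; split; [easy |].
    apply Rmult_eq_reg_l with r; lra.
  - split; [| easy]; rewrite Rabs_pos_eq by easy.
    replace (Re z ^ 2 + Im z ^ 2) with (1 - 2 * c * Im z) by nra; ring.
Qed.

Lemma circle_iff (c : R) (z : C) :
  Cmod (z + Ci * RtoC c) ^ 2 = Re z ^ 2 + (Im z + c) ^ 2.
Proof.
  rewrite Cmod_square; destruct z as [x y]; cbn -[pow]; ring.
Qed.

Definition cap_height (c x : R) : R := sqrt (1 + c ^ 2 - x ^ 2) - c.

Lemma continuous_cap_height (c x : R) : continuous (cap_height c) x.
Proof.
  unfold cap_height.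
  apply (@continuous_minus R_UniformSpace R_AbsRing R_NormedModule);
    [| apply continuous_const].
  apply continuous_sqrt_comp.
  apply (@continuous_minus R_UniformSpace R_AbsRing R_NormedModule);
    [apply continuous_const |].
  apply continuous_square_comp, continuous_id.
Qed.

Lemma cap_iff_graph (c : R) (z : C) :
  0 < c -> (cap c z <-> -1 <= Re z <= 1 /\ Im z = cap_height c (Re z)).
Proof.
  intros Hc; unfold cap, cap_height; split.
  - intros [Hy Hz]; split; [split; nra |].
    replace (1 + c ^ 2 - Re z ^ 2) with ((Im z + c) ^ 2) by lra.
    rewrite sqrt_pow2; lra.
  - intros [Hx ->].
    assert (c <= sqrt (1 + c ^ 2 - Re z ^ 2)).
    { rewrite <- (sqrt_pow2 c) at 1 by lra; apply sqrt_le_1_alt; nra. }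
    split; [lra |].
    replace (sqrt (1 + c ^ 2 - Re z ^ 2) - c + c)
      with (sqrt (1 + c ^ 2 - Re z ^ 2)) by ring.
    rewrite pow2_sqrt; nra.
Qed.

(** The abscissa, rescaled from [-1, 1] to [0, 1], is the parameter. *)
Lemma is_arc_cap (c : R) : 0 < c -> is_arc (cap c).
Proof.
  intros Hc; exists (fun t => (2 * t - 1, cap_height c (2 * t - 1))).
  split; [| split; [| split]].
  - intros t _.
    eapply filterlim_filter_le_1; [apply filter_le_within |].
    assert (Haff : continuous (fun s : R => 2 * s - 1) t).
    { apply (@continuous_minus R_UniformSpace R_AbsRing R_NormedModule);
        [| apply continuous_const].
      apply (@continuous_mult R_UniformSpace R_AbsRing);
        [apply continuous_const | apply continuous_id]. }
    apply (continuous_pair (fun s => 2 * s - 1)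
      (fun s => cap_height c (2 * s - 1))); [easy |].
    apply (continuous_comp (fun s : R => 2 * s - 1) (cap_height c));
      [easy | apply continuous_cap_height].
  - intros s t _ _ H; apply (f_equal fst) in H; simpl in H; lra.
  - intros Hz; apply cap_iff_graph in Hz as [Hx Hy]; [| easy].
    exists ((Re z + 1) / 2); split; [lra |].
    replace (2 * ((Re z + 1) / 2) - 1) with (Re z) by field.
    rewrite <- Hy; now destruct z.
  - intros (t & Ht & <-); apply cap_iff_graph; [easy | cbn; split; [lra | easy]].
Qed.

Lemma cap_real_axis (c : R) (z : C) :
  cap c z /\ Im z = 0 <-> z = RtoC (-1) \/ z = RtoC 1.
Proof.
  unfold cap; destruct z as [x y]; cbn -[pow]; split.
  - intros [[_ H] ->].
    assert (Hx : (x - 1) * (x + 1) = 0) by lra.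
    apply Rmult_integral in Hx as [Hx | Hx]; [right | left];
      unfold RtoC; f_equal; lra.
  - unfold RtoC; intros [E | E]; injection E as -> ->; repeat split; lra.
Qed.

(** * Angles and tangent lines in the plane *)

Definition cross (u v : C) : R := Re u * Im v - Im u * Re v.

Lemma cross_dot_square (u v : C) :
  cross u v ^ 2 + Re (u * Cconj v) ^ 2 = (Cmod u * Cmod v) ^ 2.
Proof.
  rewrite Rpow_mult_distr, 2 Cmod_square.
  unfold cross; destruct u, v; cbn -[pow]; ring.
Qed.

(** The arccosine in [line_angle] is not differentiable at 1, the value that
    matters for tangency; its sine is the cross product of the unit vectors,
    and both the sine and the arcsine are smooth at 0.  So angles tending to 0
    are the same as normalized cross products tending to 0. *)
Lemma line_angle_asin (u v : C) :
  u <> RtoC 0 -> v <> RtoC 0 ->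
  line_angle u v = asin (Rabs (cross u v) / (Cmod u * Cmod v)) /\
  sin (line_angle u v) = Rabs (cross u v) / (Cmod u * Cmod v).
Proof.
  intros Hu Hv; apply Cmod_gt_0 in Hu, Hv.
  assert (Hm : 0 < Cmod u * Cmod v) by now apply Rmult_lt_0_compat.
  assert (Hcd := cross_dot_square u v).
  unfold line_angle.
  set (m := Cmod u * Cmod v) in *.
  set (k := Rabs (cross u v) / m).
  set (q := Rabs (Re (u * Cconj v)) / m).
  assert (Hk : 0 <= k) by (apply Rdiv_le_0_compat; [apply Rabs_pos | easy]).
  assert (Hq : 0 <= q) by (apply Rdiv_le_0_compat; [apply Rabs_pos | easy]).
  assert (Hqk : k ^ 2 + q ^ 2 = 1).
  { unfold k, q, Rdiv; rewrite 2 Rpow_mult_distr, 2 pow2_abs.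
    rewrite <- Rmult_plus_distr_r, Hcd; field; lra. }
  assert (Hk1 : -1 <= k <= 1) by nra.
  assert (Hasin : 0 <= asin k).
  { destruct (Rle_or_lt 0 (asin k)) as [| Hneg]; [easy |].
    assert (Hb := asin_bound k); assert (HPI := PI_RGT_0).
    assert (sin (asin k) < 0) by (apply sin_lt_0_var; lra).
    rewrite sin_asin in *; lra. }
  assert (Hacos : acos q = asin k).
  { rewrite <- (acos_cos (asin k)).
    - rewrite cos_asin by easy; f_equal.
      rewrite <- (sqrt_pow2 q) by easy; f_equal; unfold Rsqr; lra.
    - assert (Hb := asin_bound k); assert (HPI := PI_RGT_0); lra. }
  rewrite Hacos; split; [easy | now apply sin_asin].
Qed.

(** Three vectors of the plane are dependent:
    [cross u v * e = cross e v * u - cross e u * v]. *)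
Lemma cross_triangle (e u v : C) :
  Rabs (cross u v) * Cmod e <=
  Rabs (cross e v) * Cmod u + Rabs (cross e u) * Cmod v.
Proof.
  rewrite <- 3 Cmod_R, <- 3 Cmod_mult.
  replace (RtoC (cross u v) * e)%C
    with (RtoC (cross e v) * u + - (RtoC (cross e u) * v))%C.
  - eapply Rle_trans; [apply Cmod_triangle |]; rewrite Cmod_opp; lra.
  - unfold cross; destruct e, u, v.
    apply injective_projections; cbn; ring.
Qed.

(** Along the points [z] of [A] tending to [p], the secant [z - p] makes
    vanishing angles with [u] and with [v].  By [cross_triangle] the sine of the
    angle of [u] and [v] is at most the sum of the sines of these two angles. *)
Lemma tangent_direction_parallel (A : C -> Prop) (p u v : C) :
  tangent_direction A p u -> tangent_direction A p v -> cross u v = 0.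
Proof.
  intros (Hu & Hcl & Hlu) (Hv & _ & Hlv).
  assert (Hu0 := proj1 (Cmod_gt_0 u) Hu).
  assert (Hv0 := proj1 (Cmod_gt_0 v) Hv).
  destruct (Req_dec (cross u v) 0) as [| Hne]; [easy | exfalso].
  set (k := Rabs (cross u v) / (Cmod u * Cmod v)).
  assert (Hk : 0 < k).
  { apply Rdiv_lt_0_compat; [now apply Rabs_pos_lt |].
    now apply Rmult_lt_0_compat. }
  assert (Hsmall : locally 0 (fun x => sin x < k / 2)).
  { apply (continuous_sin 0 (fun y => y < k / 2)), open_lt; rewrite sin_0; lra. }
  assert (Hnear : locally p (fun z => z <> p -> A z ->
    sin (line_angle (z - p) u) < k / 2 /\ sin (line_angle (z - p) v) < k / 2)).
  { exact (filter_and (F := within A (locally' p)) _ _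
      (Hlu _ Hsmall) (Hlv _ Hsmall)). }
  destruct (Hcl _ Hnear) as (z & Hsin & HA & Hz).
  destruct (Hsin Hz HA) as [Hzu Hzv].
  assert (He : (z - p)%C <> RtoC 0) by now apply Cminus_eq_contra.
  assert (He0 := proj1 (Cmod_gt_0 _) He).
  rewrite (proj2 (line_angle_asin _ _ He Hu)) in Hzu.
  rewrite (proj2 (line_angle_asin _ _ He Hv)) in Hzv.
  assert (Ht := cross_triangle (z - p) u v).
  set (e := (z - p)%C) in *.
  assert (k <= Rabs (cross e v) / (Cmod e * Cmod v)
             + Rabs (cross e u) / (Cmod e * Cmod u)); [| lra].
  unfold k.
  apply Rmult_le_reg_r with (Cmod e * Cmod u * Cmod v).
  { now repeat apply Rmult_lt_0_compat. }
  field_simplify; [lra | | ]; repeat split; lra.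
Qed.

Lemma line_angle_real_axis (u : C) :
  Re u <> 0 -> line_angle u (RtoC 1) = atan (Rabs (Im u) / Rabs (Re u)).
Proof.
  intros Hu; unfold line_angle.
  replace (u * Cconj (RtoC 1))%C with u
    by (destruct u; apply injective_projections; cbn; ring).
  rewrite Cmod_1, Rmult_1_r.
  assert (Hr : 0 < Rabs (Re u)) by now apply Rabs_pos_lt.
  assert (Hc : 0 < Cmod u).
  { apply Cmod_gt_0; intros E; apply Hu; now rewrite E. }
  rewrite acos_atan by now apply Rdiv_lt_0_compat.
  f_equal.
  replace (1 - (Rabs (Re u) / Cmod u)²) with ((Rabs (Im u) / Cmod u) ^ 2).
  - rewrite sqrt_pow2; [field; lra |].
    apply Rdiv_le_0_compat; [apply Rabs_pos | easy].
  - rewrite Rsqr_pow2; unfold Rdiv; rewrite 2 Rpow_mult_distr, 2 pow2_abs.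
    assert (H := Cmod_square u).
    replace (Im u ^ 2) with (Cmod u ^ 2 - Re u ^ 2) by lra; field; lra.
Qed.

(** * Tangents of the arc at its ends *)

Lemma continuous_asin_0 : continuous asin 0.
Proof.
  apply continuity_pt_filterlim, derivable_continuous_pt, derivable_pt_asin; lra.
Qed.

Lemma continuous_Cmod_minus (p z : C) : continuous (fun w => Cmod (w - p)) z.
Proof.
  apply (continuous_comp (fun w : C => Re (w - p)%C ^ 2 + Im (w - p)%C ^ 2) sqrt);
    [| apply continuous_sqrt].
  apply (@continuous_plus C_UniformSpace R_AbsRing R_NormedModule);
    apply continuous_square_comp;
    apply (@continuous_minus C_UniformSpace R_AbsRing R_NormedModule);
    try apply continuous_const; [apply continuous_Re | apply continuous_Im].
Qed.

(** The vector [c - i s] is orthogonal to the radius [s + i c] ending at [s].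
    For a point [z] of the circle, the equation of the circle turns the cross
    product of the chord [z - s] with [c - i s] into [|z - s|^2 / 2].  Hence the
    angle of the two is the arcsine of [|z - s|] over the diameter, which tends
    to 0. *)
Lemma cap_tangent_direction (c s : R) :
  0 < c -> s ^ 2 = 1 -> tangent_direction (cap c) (RtoC s) (c, - s).
Proof.
  intros Hc Hs.
  assert (Hu : (c, - s) <> RtoC 0) by (intros E; injection E; lra).
  assert (Hu0 := proj1 (Cmod_gt_0 _) Hu).
  assert (Hu2 : Cmod (c, - s) ^ 2 = 1 + c ^ 2)
    by (rewrite Cmod_square; cbn -[pow]; nra).
  set (m := Cmod (c, - s)) in *.
  split; [easy | split].
  - intros P HP.
    assert (Hg : continuous (fun x => (x, cap_height c x) : C) s).
    { apply continuous_pair; [apply continuous_id | apply continuous_cap_height]. }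
    assert (Hp : (s, cap_height c s) = RtoC s).
    { unfold RtoC, cap_height; f_equal; rewrite Hs.
      replace (1 + c ^ 2 - 1) with (c ^ 2) by ring; rewrite sqrt_pow2; lra. }
    rewrite <- Hp in HP; destruct (Hg P HP) as [e He].
    assert (He0 := cond_pos e).
    set (h := Rmin (e / 2) 1).
    assert (Hh : 0 < h <= 1 /\ h < e)
      by (unfold h, Rmin; destruct (Rle_dec (e / 2) 1); lra).
    assert (Hs1 : s = 1 \/ s = -1).
    { assert (Hs' : (s - 1) * (s + 1) = 0) by lra.
      apply Rmult_integral in Hs' as []; [left | right]; lra. }
    (* An abscissa in [-1, 1] at distance [h] from the end [s]. *)
    set (x := s * (1 - h)).
    exists (x, cap_height c x); split; [| split].
    + apply He; change (Rabs (x - s) < e); unfold x.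
      replace (s * (1 - h) - s) with (- (s * h)) by ring.
      rewrite Rabs_Ropp; apply Rabs_def1; destruct Hs1; subst s; lra.
    + apply cap_iff_graph; [easy |]; cbn; split; [| easy].
      unfold x; destruct Hs1; subst s; lra.
    + intros E; injection E as E _; unfold x in E; destruct Hs1; subst s; lra.
  - apply filterlim_ext_loc with (fun z => asin (Cmod (z - RtoC s) / (2 * m))).
    + exists (mkposreal 1 Rlt_0_1); intros z _ Hz [_ Hcap].
      assert (He : (z - RtoC s)%C <> RtoC 0) by now apply Cminus_eq_contra.
      rewrite (proj1 (line_angle_asin _ _ He Hu)); apply f_equal; fold m.
      assert (He0 := proj1 (Cmod_gt_0 _) He).
      assert (Hcross : cross (z - RtoC s) (c, - s) = Cmod (z - RtoC s) ^ 2 / 2).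
      { rewrite Cmod_square; unfold cross; destruct z as [x y].
        cbn -[pow] in Hcap |- *. lra. }
      rewrite Hcross, Rabs_pos_eq by nra; field; lra.
    + assert (H0 : Cmod (RtoC s - RtoC s) / (2 * m) = 0).
      { replace (RtoC s - RtoC s)%C with (RtoC 0) by ring.
        rewrite Cmod_0; field; lra. }
      assert (Hlim : continuous (fun z => asin (Cmod (z - RtoC s) / (2 * m)))
        (RtoC s)).
      { apply (continuous_comp (fun z => Cmod (z - RtoC s) / (2 * m)) asin).
        - apply (@continuous_mult C_UniformSpace R_AbsRing);
            [apply continuous_Cmod_minus | apply continuous_const].
        - rewrite H0; apply continuous_asin_0. }
      unfold continuous in Hlim; rewrite H0, asin_0 in Hlim.
      eapply filterlim_filter_le_1; [| exact Hlim].
      intros Q [e He]; exists e; intros z Hz _ _; now apply He.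
Qed.

(** Every tangent direction at [s] is parallel to [c - i s], a vector of slope
    [1 / c] in absolute value. *)
Lemma cap_cuts_under_angle (c s : R) :
  0 < c -> s ^ 2 = 1 ->
  cuts_under_angle (cap c) (RtoC s) (RtoC 1) (atan (/ c)).
Proof.
  intros Hc Hs; assert (Ht := cap_tangent_direction c s Hc Hs).
  split; [now exists (c, - s) |].
  intros u Hu.
  assert (Hpar := tangent_direction_parallel _ _ _ _ Hu Ht).
  destruct Hu as [Hu0 _]; change (Re u * - s - Im u * c = 0) in Hpar.
  assert (Habs : Rabs (Re u) = c * Rabs (Im u)).
  { assert (Hre : Re u = - (s * c) * Im u).
    { transitivity (s ^ 2 * Re u); [rewrite Hs; ring |].
      replace (s ^ 2 * Re u) with (s * (s * Re u)) by ring.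
      replace (s * Re u) with (- Im u * c) by lra; ring. }
    rewrite Hre, Rabs_mult, Rabs_Ropp, Rabs_mult, (Rabs_pos_eq c) by lra.
    replace (Rabs s) with 1; [ring |].
    rewrite <- sqrt_Rsqr_abs, Rsqr_pow2, Hs; symmetry; apply sqrt_1. }
  assert (Hre : Re u <> 0).
  { intros E; rewrite E, Rabs_R0 in Habs.
    assert (Him : Rabs (Im u) = 0) by nra; apply Rabs_eq_0 in Him.
    apply Hu0, injective_projections; [exact E | exact Him]. }
  rewrite line_angle_real_axis by easy; f_equal.
  assert (0 < Rabs (Re u)) by now apply Rabs_pos_lt.
  rewrite Habs in *; field; split; nra.
Qed.

(** * The theorem *)

Theorem theorem3p1 (r : R) (hr : 0 < r < 1) :
  (is_arc_of
     (fun w : C =>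
        Cmod (w + Ci * RtoC ((1 - r ^ 2) / (2 * r)))%C = (1 + r ^ 2) / (2 * r))
     (upper_boundary (U r)) /\
   (forall w : C, lower_boundary (U r) w <->
      exists z : C, upper_boundary (U r) z /\ w = Cconj z)) /\
  ((forall w : C, upper_boundary (U r) w /\ Im w = 0 <->
      w = RtoC (-1) \/ w = RtoC 1) /\
   exists beta : R,
     0 < beta < PI / 2 /\
     cuts_under_angle (upper_boundary (U r)) (RtoC (-1)) (RtoC 1) beta /\
     cuts_under_angle (upper_boundary (U r)) (RtoC 1) (RtoC 1) beta /\
     tan beta = 2 * r / (1 - r ^ 2)).
Proof.
  assert (Hc : 0 < (1 - r ^ 2) / (2 * r)) by (apply Rdiv_lt_0_compat; nra).
  split; [split |]; [split | | split].
  - rewrite upper_boundary_U by easy; now apply is_arc_cap.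
  - intros z; rewrite upper_boundary_U by easy; intros [_ Hz].
    rewrite <- circle_iff in Hz.
    assert (Hrad : 0 < (1 + r ^ 2) / (2 * r)) by (apply Rdiv_lt_0_compat; nra).
    apply Rsqr_inj; [apply Cmod_ge_0 | lra |].
    rewrite 2 Rsqr_pow2, Hz; field; lra.
  - assert (Hconj : forall z, boundary (U r) (Cconj z) <-> boundary (U r) z).
    { intros z; rewrite 2 boundary_U_iff by easy; unfold lens_defect.
      cbn -[pow]; now rewrite Rabs_Ropp, <- (pow2_abs (- _)), Rabs_Ropp, pow2_abs. }
    intros w; split.
    + intros [Hb Hw]; exists (Cconj w).
      split; [split; [now apply Hconj |] | now rewrite Cconj_conj].
      cbn; unfold Im in Hw; lra.
    + intros (z & [Hb Hz] & ->); split; [now apply Hconj |].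
      cbn; unfold Im in Hz; lra.
  - intros w; rewrite upper_boundary_U by easy; apply cap_real_axis.
  - exists (atan (/ ((1 - r ^ 2) / (2 * r)))).
    rewrite upper_boundary_U by easy.
    assert (Hinv := Rinv_0_lt_compat _ Hc).
    split; [split | split; [| split]].
    + rewrite <- atan_0; now apply atan_increasing.
    + apply atan_bound.
    + apply cap_cuts_under_angle; [easy | ring].
    + apply cap_cuts_under_angle; [easy | ring].
    + rewrite tan_atan; field; split; nra.
Qed.
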